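(* For every cardinal number $\kappa\geq 2$, the theory $\mathrm{LA}_\kappa$ ($\kappa$-linear arithmetic) is not model complete.
   Context: For a cardinal number $\kappa$, $\kappa$-linear arithmetic $\mathrm{LA}_\kappa$ is the first-order theory in the language $\langle 0,1,+,\leq,a_\alpha\rangle_{\alpha\in\kappa}$, where each $a_\alpha$ is a unary function symbol (and $a_\alpha x$ denotes its value at $x$), with the following axioms (universally closed), for all $\alpha,\beta\in\kappa$: (A1) $0\neq z+1$; (A2) $x+1=y+1\rightarrow x=y$; (A3) $x+0=x$; (A4) $x+(y+1)=(x+y)+1$; (D$_\leq$) $x\leq y\leftrightarrow (\exists z)(x+z=y)$; (L1) $a_\alpha(x+1)=a_\alpha x+a_\alpha 1$; (L2) $a_\alpha(a_\beta x)=a_\beta(a_\alpha x)$; (Ind) $\bigl(\varphi(0,\overline{y})\wedge(\forall x)(\varphi(x,\overline{y})\rightarrow\varphi(x+1,\overline{y}))\bigr)\rightarrow(\forall x)\varphi(x,\overline{y})$ for all formulas $\varphi(x,\overline{y})$ of the language. A theory $T$ is model complete if every embedding between models of $T$ is elementary (equivalently, every formula is equivalent modulo $T$ to an existential formula). *)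

(* Defs.v *)
Set Implicit Arguments.
Unset Strict Implicit.
Unset Printing Implicit Defensive.

(** * First-order logic with equality over <0, 1, +, <=, a_k>_{k in K}

    The cardinal indexing the unary function symbols is represented by an
    arbitrary type [K].  Variables are de Bruijn indices: under a quantifier,
    index 0 is the bound variable and all other indices are shifted by one. *)

Inductive term (K : Type) : Type :=
| Var : nat -> term K
| Zero : term K
| One : term K
| Add : term K -> term K -> term K
| App : K -> term K -> term K.

Arguments Var {K} n.
Arguments Zero {K}.
Arguments One {K}.

Inductive formula (K : Type) : Type :=
| Eq : term K -> term K -> formula K
| Le : term K -> term K -> formula K
| Bot : formula K
| And : formula K -> formula K -> formula K
| Or : formula K -> formula K -> formula K
| Imp : formula K -> formula K -> formula K
| All : formula K -> formula K
| Ex : formula K -> formula K.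

Arguments Bot {K}.

Definition Not (K : Type) (p : formula K) : formula K := Imp p Bot.
Definition Iff (K : Type) (p q : formula K) : formula K :=
  And (Imp p q) (Imp q p).

Fixpoint subst_term (K : Type) (s : nat -> term K) (t : term K) : term K :=
  match t with
  | Var n => s n
  | Zero => Zero
  | One => One
  | Add t1 t2 => Add (subst_term s t1) (subst_term s t2)
  | App a t1 => App a (subst_term s t1)
  end.

(* Extends a substitution under a binder, avoiding capture. *)
Definition up (K : Type) (s : nat -> term K) (n : nat) : term K :=
  match n with
  | O => Var 0
  | S m => subst_term (fun i => Var (S i)) (s m)
  end.

Fixpoint subst (K : Type) (s : nat -> term K) (p : formula K) : formula K :=
  match p with
  | Eq t1 t2 => Eq (subst_term s t1) (subst_term s t2)
  | Le t1 t2 => Le (subst_term s t1) (subst_term s t2)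
  | Bot => Bot
  | And p1 p2 => And (subst s p1) (subst s p2)
  | Or p1 p2 => Or (subst s p1) (subst s p2)
  | Imp p1 p2 => Imp (subst s p1) (subst s p2)
  | All p1 => All (subst (up s) p1)
  | Ex p1 => Ex (subst (up s) p1)
  end.

(** * Structures and satisfaction *)

Record structure (K : Type) : Type := Structure {
  carrier :> Type;
  szero : carrier;
  sone : carrier;
  sadd : carrier -> carrier -> carrier;
  sle : carrier -> carrier -> Prop;
  sapp : K -> carrier -> carrier
}.

Arguments szero {K} s.
Arguments sone {K} s.

Definition scons (A : Type) (x : A) (r : nat -> A) (n : nat) : A :=
  match n with
  | O => x
  | S m => r m
  end.

Fixpoint eval (K : Type) (M : structure K) (r : nat -> M) (t : term K) : M :=
  match t with
  | Var n => r n
  | Zero => szero M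
  | One => sone M
  | Add t1 t2 => sadd (eval r t1) (eval r t2)
  | App a t1 => sapp a (eval r t1)
  end.

Fixpoint sat (K : Type) (M : structure K) (r : nat -> M) (p : formula K)
  : Prop :=
  match p with
  | Eq t1 t2 => eval r t1 = eval r t2
  | Le t1 t2 => sle (eval r t1) (eval r t2)
  | Bot => False
  | And p1 p2 => sat r p1 /\ sat r p2
  | Or p1 p2 => sat r p1 \/ sat r p2
  | Imp p1 p2 => sat r p1 -> sat r p2
  | All p1 => forall x : M, sat (scons x r) p1
  | Ex p1 => exists x : M, sat (scons x r) p1
  end.

Definition theory (K : Type) : Type := formula K -> Prop.

(* Axioms may have free variables; quantifying over all assignments [r]
   amounts to taking their universal closures. *)
Definition models (K : Type) (M : structure K) (T : theory K) : Prop :=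
  forall p : formula K, T p -> forall r : nat -> M, sat r p.

Record embedding (K : Type) (M N : structure K) (h : M -> N) : Prop := {
  emb_inj : forall x y : M, h x = h y -> x = y;
  emb_zero : h (szero M) = szero N;
  emb_one : h (sone M) = sone N;
  emb_add : forall x y : M, h (sadd x y) = sadd (h x) (h y);
  emb_app : forall (a : K) (x : M), h (sapp a x) = sapp a (h x);
  emb_le : forall x y : M, sle x y <-> sle (h x) (h y)
}.

Definition elementary (K : Type) (M N : structure K) (h : M -> N) : Prop :=
  forall (p : formula K) (r : nat -> M),
    sat r p <-> sat (fun n => h (r n)) p.

Definition model_complete (K : Type) (T : theory K) : Prop :=
  forall M N : structure K, models M T -> models N T ->
  forall h : M -> N, embedding h -> elementary h.

(** * Linear arithmetic *)

(* phi(0, y), where index 0 of phi is the variable x and the parameters y are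
   the indices from 1 on. *)
Definition at_zero (K : Type) (p : formula K) : formula K :=
  subst (scons Zero (fun n => Var n)) p.

(* phi(x + 1, y), with x still at index 0. *)
Definition at_succ (K : Type) (p : formula K) : formula K :=
  subst (scons (Add (Var 0) One) (fun n => Var (S n))) p.

Inductive LA (K : Type) : theory K :=
| A1 : LA (Not (Eq Zero (Add (Var 0) One)))
| A2 : LA (Imp (Eq (Add (Var 0) One) (Add (Var 1) One)) (Eq (Var 0) (Var 1)))
| A3 : LA (Eq (Add (Var 0) Zero) (Var 0))
| A4 : LA (Eq (Add (Var 0) (Add (Var 1) One)) (Add (Add (Var 0) (Var 1)) One))
| D_le : LA (Iff (Le (Var 0) (Var 1)) (Ex (Eq (Add (Var 1) (Var 0)) (Var 2))))
| L1 (a : K) :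
    LA (Eq (App a (Add (Var 0) One)) (Add (App a (Var 0)) (App a One)))
| L2 (a b : K) : LA (Eq (App a (App b (Var 0))) (App b (App a (Var 0))))
| Ind (p : formula K) :
    LA (Imp (And (at_zero p) (All (Imp p (at_succ p)))) (All p)).

(* Main.v *)
(** Let [v] be a point of a definable set [P] of pairs, and call [v] extreme if it
    is not the midpoint of two points of [P] with different abscissas.  This is a
    universal property, and model completeness fails because an embedding can
    destroy it.  Take the standard models with scalars [a = F_{2k+1}] and
    [b = F_{2k}]: in the cone [0 < u], [a v <= b u], the points
    [(F_{2i+1}, F_{2i})] for [i <= k] are all extreme.  Let [M] and [N] be the
    ultraproducts of these models over indices [(i, k)] and [(i, (j, k))], for the
    iterated products of one nonprincipal ultrafilter.  The two projections
    [(i, (j, k)) |-> (i, k), (j, k)] pull [M] back to [N] in two ways, which agree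
    in parity, so their average is an embedding of [M] in [N].  It sends the
    extreme point of [M] with coordinates [(F_{2i+1}, F_{2i})] to the midpoint of
    two distinct points of the cone of [N]. *)

From mathcomp Require Import all_boot zify boolp classical_sets filter.
Require Import Defs.

Set Implicit Arguments.
Unset Strict Implicit.
Unset Printing Implicit Defensive.

(** * Ultrafilters *)

(* Boolean homomorphisms [(I -> Prop) -> Prop] are exactly the ultrafilters on [I]. *)
Record ultrafilter (I : Type) : Type := Ultrafilter {
  large :> (I -> Prop) -> Prop;
  large_and : forall P Q, large (fun i => P i /\ Q i) <-> large P /\ large Q;
  large_not : forall P, large (fun i => ~ P i) <-> ~ large P
}.

Section Ultrafilters.
Variables (I : Type) (U : ultrafilter I).
Implicit Types P Q : I -> Prop.

Lemma large_sub P Q : (forall i, P i -> Q i) -> U P -> U Q.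
Proof.
move=> PQ UP; suff: U (fun i => P i /\ Q i) by move/large_and => [].
by have -> : (fun i => P i /\ Q i) = P by apply/predeqP => i; split=> [[]|/[dup] /PQ].
Qed.

Lemma large_sub2 P Q (R : I -> Prop) :
  (forall i, P i -> Q i -> R i) -> U P -> U Q -> U R.
Proof.
move=> PQR UP UQ; apply: (@large_sub (fun i => P i /\ Q i)).
  by move=> i [/PQR]; apply.
exact/large_and.
Qed.

Lemma large_iff P Q : (forall i, P i <-> Q i) -> (U P <-> U Q).
Proof. by move=> PQ; split; apply: large_sub => i /PQ. Qed.

Lemma large_congr P Q (R : I -> Prop) :
  U R -> (forall i, R i -> (P i <-> Q i)) -> (U P <-> U Q).
Proof.
by move=> UR PQ; split=> UP; apply: large_sub2 UR UP => i /PQ[].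
Qed.

Lemma large_const (A : Prop) : U (fun _ => A) <-> A.
Proof.
have nF : ~ U (fun _ => False).
  move=> UF; have : ~ U (fun _ => False) by apply/large_not; exact: large_sub UF.
  exact.
split=> [UA|a]; first by apply: contrapT => nA; apply/nF/(large_sub _ UA).
apply: contrapT => /large_not UnA.
by apply/nF/(large_sub _ UnA) => _; apply.
Qed.

Lemma large_all P : (forall i, P i) -> U P.
Proof. by move=> Pi; apply: (@large_sub (fun _ => True)) => //; apply/large_const. Qed.

Lemma large_ex P : U P -> exists i, P i.
Proof.
move=> UP; apply: contrapT => nP; apply/(large_const False)/(large_sub _ UP).
by move=> i Pi; apply: nP; exists i.
Qed.

Lemma large_or P Q : U (fun i => P i \/ Q i) <-> U P \/ U Q.
Proof.
split=> [UPQ|[]]; try by apply: large_sub; tauto.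
apply: contrapT => /not_orP[/large_not UnP /large_not UnQ].
apply/(large_const False)/(large_sub2 _ UPQ (large_sub2 (R := fun i => ~ P i /\ ~ Q i) _ UnP UnQ)); tauto.
Qed.

Lemma large_imp P Q : U (fun i => P i -> Q i) <-> (U P -> U Q).
Proof.
split=> [UPQ UP|PQ]; first by apply: (large_sub2 _ UPQ UP); tauto.
have [/PQ|/large_not] := pselect (U P); apply: large_sub; tauto.
Qed.

End Ultrafilters.

(** The filter of cofinite sets extends to an ultrafilter. *)
Lemma nonprincipal_ultrafilter :
  exists U : ultrafilter nat, forall n, U (fun i => n <= i).
Proof.
have [G [GU sG]] := ultraFilterLemma eventually_filter.
have Gand P Q : G (fun i => P i /\ Q i) <-> G P /\ G Q.
  split=> [GPQ|[GP GQ]]; last exact: filterI.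
  by split; apply: filterS GPQ => i [].
have Gnot P : G (fun i => ~ P i) <-> ~ G P.
  split=> [GnP GP|nGP].
    by apply: (filter_not_empty G); apply: filterS (filterI GP GnP) => i [].
  by have [|] := in_ultra_setVsetC P GU.
exists (Ultrafilter Gand Gnot) => n /=.
by apply: sG; exists n.
Qed.

(* [i] is quantified first, so [j] is large compared to [i]. *)
Definition uf_prod (I J : Type) (U : ultrafilter I) (V : ultrafilter J) :
  ultrafilter (I * J).
Proof.
exists (fun P => U (fun i => V (fun j => P (i, j)))) => [P Q|P].
- rewrite -large_and; apply: large_iff => i; exact: large_and.
- rewrite -large_not; apply: large_iff => i; exact: large_not.
Defined.

(** * Ultraproducts *)

Section Ultraproduct.
Variables (K I : Type) (U : ultrafilter I) (S : I -> structure K).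

Local Notation fam := (forall i, S i).
Implicit Types f g : fam.

Definition ueq f g : Prop := U (fun i => f i = g i).

(** A class is stored as the predicate of its members, so that [Eq] is interpreted by genuine
    equality. *)
Definition ucarrier : Type := {P : fam -> Prop | exists f, P = ueq f}.

Definition cls f : ucarrier := exist _ (ueq f) (ex_intro _ f erefl).

Definition repr (x : ucarrier) : fam := sval (cid (svalP x)).

Lemma cls_eqP f g : cls f = cls g <-> U (fun i => f i = g i).
Proof.
split=> [[/(congr1 (@^~ g)) e]|Ufg].
  have : ueq g g by apply: large_all.
  by rewrite -e.
apply: eq_exist => /=; apply/predeqP => f'; split; apply: large_sub2 Ufg => i -> //.
Qed.

Lemma reprK x : cls (repr x) = x.
Proof.
by case: x => P fP; apply: eq_exist; rewrite /repr; case: cid => f /= ->.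
Qed.

Lemma repr_cls f : U (fun i => repr (cls f) i = f i).
Proof. by apply/cls_eqP; rewrite reprK. Qed.

Definition uprod : structure K := {|
  carrier := ucarrier;
  szero := cls (fun i => szero (S i));
  sone := cls (fun i => sone (S i));
  sadd := fun x y => cls (fun i => sadd (repr x i) (repr y i));
  sle := fun x y => U (fun i => sle (repr x i) (repr y i));
  sapp := fun a x => cls (fun i => sapp a (repr x i))
|}.

Lemma eval_uprod (r : nat -> fam) t :
  eval (M := uprod) (fun n => cls (r n)) t = cls (fun i => eval (r^~ i) t).
Proof.
elim: t => //= [t1 -> t2 ->|a t ->]; apply/cls_eqP.
- set f := fun i => eval _ t1; set g := fun i => eval _ t2.
  by apply: (large_sub2 _ (repr_cls f) (repr_cls g)) => i -> ->.
- by apply: (large_sub _ (repr_cls (fun i => eval (r^~ i) t))) => i ->.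
Qed.

Lemma scons_cls f (r : nat -> fam) :
  scons (cls f) (fun n => cls (r n)) = fun n => cls (scons f r n).
Proof. by apply: funext; case. Qed.

Lemma scons_app f (r : nat -> fam) i :
  (fun n => scons f r n i) = scons (f i) (r^~ i).
Proof. by apply: funext; case. Qed.

Lemma los_ex (P : forall i, S i -> Prop) :
  U (fun i => exists x, P i x) <-> exists f, U (fun i => P i (f i)).
Proof.
split=> [UP|[f]]; last by apply: large_sub => i; exists (f i).
have fP i : exists x, (exists x, P i x) -> P i x.
  have [[x Px]|nP] := pselect (exists x, P i x); first by exists x.
  (* Default value at an index without witness. *)
  by exists (szero (S i)).
by exists (fun i => sval (cid (fP i))); apply: large_sub UP => i; case: cid.
Qed.

(** Łoś's theorem; at a quantifier, a witness or a counterexample is chosen at each index by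
    [los_ex]. *)
Theorem los p (r : nat -> fam) :
  sat (M := uprod) (fun n => cls (r n)) p <-> U (fun i => sat (r^~ i) p).
Proof.
elim: p r => [t1 t2|t1 t2||p IHp q IHq|p IHp q IHq|p IHp q IHq|p IHp|p IHp] r /=.
- by rewrite !eval_uprod cls_eqP.
- rewrite !eval_uprod; set f := fun i => eval _ t1; set g := fun i => eval _ t2.
  have fg : U (fun i => repr (cls f) i = f i /\ repr (cls g) i = g i).
    by rewrite large_and; split; exact: repr_cls.
  by apply: large_congr fg _ => i [-> ->].
- by rewrite large_const.
- by rewrite IHp IHq large_and.
- by rewrite IHp IHq large_or.
- by rewrite IHp IHq large_imp.
- split=> [all_p|Up x].
    apply: contrapT => /large_not Un.
    have /los_ex[f] : U (fun i => exists x : S i, ~ sat (scons x (r^~ i)) p).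
      by apply: large_sub Un => i /existsNP.
    rewrite (large_not U (fun i => sat (scons (f i) _) p)); apply.
    have := all_p (cls f); rewrite scons_cls IHp.
    by apply: large_sub => i; rewrite scons_app.
  rewrite -(reprK x) scons_cls IHp.
  by apply: large_sub Up => i /(_ (repr x i)); rewrite scons_app.
- rewrite los_ex; split=> [[x]|[f Uf]].
    rewrite -{1}(reprK x) scons_cls IHp => Ux; exists (repr x).
    by apply: large_sub Ux => i; rewrite scons_app.
  exists (cls f); rewrite scons_cls IHp.
  by apply: large_sub Uf => i; rewrite scons_app.
Qed.

Lemma models_uprod (T : theory K) :
  (forall i, models (S i) T) -> models uprod T.
Proof.
move=> ST p Tp r.
have -> : r = fun n => cls (repr (r n)) by apply: funext => n; rewrite reprK.
by apply/los/large_all => i; apply: ST.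
Qed.

End Ultraproduct.

(** * Linear arithmetic on the natural numbers *)

Section Substitution.
Variables (K : Type) (M : structure K).
Implicit Types (r : nat -> M) (s : nat -> term K).

Lemma eval_subst r s t :
  eval r (subst_term s t) = eval (fun n => eval r (s n)) t.
Proof. by elim: t => //= [t1 -> t2 ->|a t ->]. Qed.

Lemma scons_up r s x :
  (fun n => eval (scons x r) (up s n)) = scons x (fun n => eval r (s n)).
Proof. by apply: funext; case=> //= n; rewrite eval_subst. Qed.

Lemma sat_subst p r s :
  sat r (subst s p) <-> sat (fun n => eval r (s n)) p.
Proof.
elim: p r s => [t1 t2|t1 t2||p IHp q IHq|p IHp q IHq|p IHp q IHq|p IHp|p IHp] r s /=;
  rewrite ?eval_subst ?IHp ?IHq //.
- by split=> sat_p x; have := sat_p x; rewrite IHp scons_up.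
- by split=> -[x sat_p]; exists x; move: sat_p; rewrite IHp scons_up.
Qed.

End Substitution.

Definition scaled (K : Type) (c : K -> nat) : structure K := {|
  carrier := nat;
  szero := 0;
  sone := 1;
  sadd := addn;
  sle := leq;
  sapp := fun a x => c a * x
|}.

(** [L1] is distributivity, [L2] commutativity of multiplication, and [Ind] is induction on [nat]
    once the substitutions are evaluated. *)
Lemma models_scaled (K : Type) (c : K -> nat) : models (scaled c) (@LA K).
Proof.
move=> p; case=> {p} [||||| a|a b|p] r /=; try by lia.
- by split=> [le|[z]]; [exists (r 1 - r 0)|]; lia.
- case=> /sat_subst p0 pS; elim=> [|n IHn].
    by move: p0; congr sat; apply: funext; case.
  have /sat_subst := pS n IHn; congr sat; apply: funext; case=> //=; lia.
Qed.

(** * Extreme points of Fibonacci cones *)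

Definition in_cone (a b u v : nat) : Prop := u <> 0 /\ a * v <= b * u.

(** Doubling replaces halving, and the conjunctions are grouped as in [cone_vertex_fm], so that
    [sat_cone_vertex] holds by computation. *)
Definition cone_vertex (a b u v : nat) : Prop :=
  forall u1 v1 u2 v2, (in_cone a b u1 v1 /\ in_cone a b u2 v2) /\
    (u1 + u2 = u + u /\ v1 + v2 = v + v) -> u1 = u2.

Fixpoint fib (n : nat) : nat :=
  if n is n'.+1 then if n' is n''.+1 then fib n' + fib n'' else 1 else 0.

Lemma fibSS n : fib n.+2 = fib n.+1 + fib n. Proof. by []. Qed.

(** The addition formulas, proved together; in the second, [fib n.+1 - fib n] stands for the
    Fibonacci number before [fib n]. *)
Lemma fibD m n :
  fib (m + n).+1 = fib m * fib n + fib m.+1 * fib n.+1 /\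
  fib (m + n) + fib m * fib n = fib m * fib n.+1 + fib m.+1 * fib n.
Proof.
elim: n => [|n [IH1 IH2]]; first by rewrite addn0 /=; lia.
by rewrite addnS !fibSS; nia.
Qed.

(** Cassini's identity: [(q, p)] and [(p, q - p)] have determinant 1 for [q = fib n.*2.+1],
    [p = fib n.*2]. *)
Lemma fib_cassini n :
  fib n.*2.+1 * fib n.*2.+1 =
  fib n.*2 * fib n.*2.+1 + fib n.*2 * fib n.*2 + 1.
Proof. by elim: n => // n; rewrite doubleS !fibSS; nia. Qed.

Lemma fib_lt n : fib n.*2 < fib n.*2.+1 < fib n.+1.*2.+1.
Proof. by elim: n => // n; rewrite !doubleS !fibSS; lia. Qed.

Lemma fib_odd_inj i j : fib i.*2.+1 = fib j.*2.+1 -> i = j.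
Proof.
have mono : {mono (fun n => fib n.*2.+1) : m n / m < n}.
  by apply/leqW_mono/leq_mono; apply: homo_ltn => [x y z|n]; [exact: ltn_trans|];
    have /andP[] := fib_lt n.
move=> e; have := mono i j; have := mono j i; rewrite e ltnn; lia.
Qed.

(** With [d = q - p], the form [a * v - b * u] takes the values [- P] and [Q] on the basis [(q, p)],
    [(p, d)], so the cone gives [Q * t <= P * s] in coordinates [(s, t)]. If [0 <= t], then [P < Q]
    makes [t < s] unless both vanish, and [s < 2] because the second abscissa is positive. Hence
    [t = 0] and [s = 1]: both abscissas are [q]. *)
Lemma unimodular_cone_vertex (a b p q P Q : nat) :
  a = P * p + Q * q -> b + P * p = P * q + Q * p ->
  q * q = p * q + p * p + 1 -> P < Q -> p < q -> cone_vertex a b q p.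
Proof.
move=> -> bE det PQ pq u1 v1 u2 v2 [[[u1_gt0 c1] [u2_gt0 c2]] [uE vE]].
have [d qE] : exists d, q = p + d by exists (q - p); lia.
subst q; have {}bE : b = P * d + Q * p by lia.
subst b.
(* In the unimodular basis [(q, p), (p, d)] the first point is [(s, t)] and the
   second [(2 - s, - t)]. *)
wlog ge_v1 : u1 v1 u2 v2 u1_gt0 u2_gt0 c1 c2 uE vE / u1 * p <= v1 * (p + d).
  move=> wl; have [|lt_v1] := leqP (u1 * p) (v1 * (p + d)); first exact: (wl _ _ u2 v2).
  apply/esym/(wl u2 v2 u1 v1) => //; rewrite 1?addnC //.
  have := congr1 (muln^~ p) uE; have := congr1 (muln^~ (p + d)) vE => /=; lia.
(* By Cramer's rule [t = v1 * q - u1 * p], and [s = u1 * d - v1 * p] below. *)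
have [t tE] : exists t, v1 * (p + d) = u1 * p + t.
  by exists (v1 * (p + d) - u1 * p); lia.
have le_s : Q * t + P * (v1 * p) <= P * (u1 * d).
  by have := congr1 (muln Q) tE; lia.
have u1_det : u1 * d * (p + d) + t * p = v1 * p * (p + d) + u1.
  by have := congr1 (muln p) tE; have := congr1 (muln u1) det; lia.
have [s sE] : exists s, u1 * d = v1 * p + s.
  exists (u1 * d - v1 * p); rewrite subnKC //.
  have [t0|t_gt0] := posnP t.
    by rewrite -(leq_pmul2r (m := p + d)); lia.
  have Qt_gt0 : 0 < Q * t by rewrite muln_gt0; lia.
  have : P * (v1 * p) < P * (u1 * d) by lia.
  by rewrite ltn_mul2l => /andP[_ /ltnW].
have {}le_s : Q * t <= P * s by have := congr1 (muln P) sE; lia.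
have u1E : u1 = s * (p + d) + t * p.
  by have := congr1 (muln^~ (p + d)) sE => /=; lia.
have s_lt2 : s < 2 by rewrite -(ltn_pmul2r (m := p + d)); lia.
have t0 : t = 0 by move: s_lt2 le_s; case: s {sE u1E} => [|[|]] // _; case: t {u1_det tE} => // t; rewrite mulnS; lia.
by move: u1E; rewrite t0; case: s s_lt2 {sE le_s} => [|[|]] //; lia.
Qed.

(** The vector [(fib k.*2.+1, fib k.*2)] has coordinates [(Q, P)] in the unimodular basis attached
    to [i]; by [fibD] they are Fibonacci numbers too. *)
Lemma fib_split i k : i <= k -> exists P Q,
  [/\ P < Q, fib k.*2.+1 = P * fib i.*2 + Q * fib i.*2.+1 &
      fib k.*2 + P * fib i.*2 = P * fib i.*2.+1 + Q * fib i.*2].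
Proof.
move=> ik; exists (fib (k - i).*2), (fib (k - i).*2.+1).
have [] := fibD (k - i).*2 i.*2; rewrite -doubleD subnK // => D1 D2.
by split=> //; have /andP[] := fib_lt (k - i).
Qed.

Lemma fib_in_cone i k : i <= k ->
  in_cone (fib k.*2.+1) (fib k.*2) (fib i.*2.+1) (fib i.*2).
Proof.
move=> /fib_split[P [Q [_ -> bE]]]; split; first by have := fib_lt i; lia.
(* The products combine to [b * q = a * p + P], where [(q, p)] is the point and [a], [b] are the
   scalars. *)
have := congr1 (muln^~ (fib i.*2.+1)) bE.
have := congr1 (muln P) (fib_cassini i) => /=; lia.
Qed.

Lemma fib_cone_vertex i k : i <= k ->
  cone_vertex (fib k.*2.+1) (fib k.*2) (fib i.*2.+1) (fib i.*2).
Proof.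
move=> /fib_split[P [Q [PQ aE bE]]].
apply: unimodular_cone_vertex aE bE _ PQ _; first exact: fib_cassini.
by have /andP[] := fib_lt i.
Qed.

Definition in_cone_fm (K : Type) (a b : K) (u v : term K) : formula K :=
  And (Not (Eq u Zero)) (Le (App a v) (App b u)).

Definition cone_vertex_fm (K : Type) (a b : K) : formula K :=
  All (All (All (All (Imp
    (And (And (in_cone_fm a b (Var 3) (Var 2)) (in_cone_fm a b (Var 1) (Var 0)))
         (And (Eq (Add (Var 3) (Var 1)) (Add (Var 4) (Var 4)))
              (Eq (Add (Var 2) (Var 0)) (Add (Var 5) (Var 5)))))
    (Eq (Var 3) (Var 1)))))).

Lemma sat_cone_vertex (K : Type) (a b : K) (c : K -> nat) (r : nat -> nat) :
  sat (M := scaled c) r (cone_vertex_fm a b) <->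
  cone_vertex (c a) (c b) (r 0) (r 1).
Proof. by []. Qed.

(** * The embedding that averages two pullbacks *)

Section Midpoint.
Variables (K I J : Type) (U : ultrafilter I) (W : ultrafilter J).
Variables (f g : J -> I) (c : I -> K -> nat).
Hypothesis push_f : forall P, U P -> W (P \o f).
Hypothesis push_g : forall P, U P -> W (P \o g).
Hypothesis cfg : forall j, c (f j) = c (g j).

Let S i := scaled (c i).
Let T j := scaled (c (f j)).
Let M := uprod U S.
Let N := uprod W T.

(** Rounding is harmless: the two values have the same parity on a large set. *)
Definition mid (x : I -> nat) (j : J) : nat := (x (f j) + x (g j))./2.

Definition midpoint (x : M) : N := cls W (S := T) (mid (repr x)).

Lemma large_pair (P : I -> Prop) : U P -> W (fun j => P (f j) /\ P (g j)).
Proof. by move=> UP; rewrite large_and; split; [exact: push_f|exact: push_g]. Qed.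

Lemma repr_midpoint (x : M) : W (fun j => repr (midpoint x) j = mid (repr x) j).
Proof. exact: repr_cls. Qed.

Lemma midpoint_cls (x : I -> nat) :
  midpoint (cls U (S := S) x) = cls W (S := T) (mid x).
Proof.
apply/cls_eqP; apply: large_sub (large_pair (repr_cls U (S := S) x)) => j [].
by rewrite /mid => -> ->.
Qed.

(** The ultrafilter [U] decides the parity of [x], and both pullbacks inherit the decision. *)
Lemma large_same_parity (x : I -> nat) :
  W (fun j => odd (x (f j)) = odd (x (g j))).
Proof.
have : U (fun i => odd (x i)) \/ U (fun i => ~ odd (x i)).
  by rewrite -large_or; apply: large_all => i; case: odd; [left|right].
by case=> /large_pair; apply: large_sub => j []; do 2!case: odd.
Qed.

Lemma midpoint_lt (x y : M) :
  U (fun i => repr x i < repr y i) -> W (fun j => mid (repr x) j < mid (repr y) j).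
Proof. by move=> /large_pair; apply: large_sub => j []; rewrite /mid; lia. Qed.

Lemma midpoint_le (x y : M) : sle x y <-> sle (midpoint x) (midpoint y).
Proof.
have -> : sle (midpoint x) (midpoint y) <->
          W (fun j => mid (repr x) j <= mid (repr y) j).
  have rep := iffRL (large_and W _ _) (conj (repr_midpoint x) (repr_midpoint y)).
  by apply: large_congr rep _ => j [-> ->].
split=> /= [/large_pair|].
  by apply: large_sub => j []; rewrite /mid /=; lia.
apply: contraPP => nle.
(* The order is total at each index, so the negation of [<=] is a strict inequality on a large
   set. *)
have /midpoint_lt lt : U (fun i => repr y i < repr x i).
  by move/large_not: nle; apply: large_sub => i /=; lia.
by move=> le; have [j []] := large_ex (iffRL (large_and W _ _) (conj lt le)); lia.
Qed.

Lemma sle_antisym (x y : M) : sle x y -> sle y x -> x = y.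
Proof.
move=> xy yx; rewrite -(reprK x) -(reprK y); apply/cls_eqP.
by apply: large_sub2 xy yx => i /=; lia.
Qed.

Lemma sle_refl_N (x : N) : sle x x.
Proof. by apply: large_all => j /=. Qed.

Lemma midpoint_embedding : embedding midpoint.
Proof.
split.
- by move=> x y e; apply: sle_antisym; apply/midpoint_le; rewrite e; exact: sle_refl_N.
- by rewrite midpoint_cls.
- by rewrite midpoint_cls.
- move=> x y; rewrite midpoint_cls; apply/cls_eqP.
  (* Equal parities make the half sums exact, hence additive. *)
  have par := iffRL (large_and W _ _)
    (conj (large_same_parity (repr x)) (large_same_parity (repr y))).
  have rep := iffRL (large_and W _ _) (conj (repr_midpoint x) (repr_midpoint y)).
  by apply: (large_sub2 _ par rep) => j [? ?] [/= -> ->]; rewrite /mid; lia.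
- move=> a x; rewrite midpoint_cls; apply/cls_eqP.
  apply: (large_sub2 _ (large_same_parity (repr x)) (repr_midpoint x)) => j par /= ->.
  (* By [cfg] a common scalar factors out of the sum, which is even. *)
  rewrite /mid /= -cfg -mulnDr -[in LHS](even_halfK (n := _ + _)) ?oddD ?par ?addbb //.
  by rewrite -doubleMr doubleK.
- exact: midpoint_le.
Qed.

End Midpoint.

(** * The two ultraproducts of Fibonacci models *)

Theorem mainTheorem2 (K : Type) (hK : exists a b : K, a <> b) :
  ~ model_complete (@LA K).
Proof.
move: hK => [a [b ab]] mc; case: nonprincipal_ultrafilter => U0 U0_ge.
(* Every symbol other than [a] acts like [b]. *)
pose c k x := if pselect (x = a) then fib k.*2.+1 else fib k.*2.
have ca k : c k a = fib k.*2.+1 by rewrite /c; case: pselect.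
have cb k : c k b = fib k.*2 by rewrite /c; case: pselect => // ba; case: ab.
pose U := uf_prod U0 U0; pose W := uf_prod U0 U.
(* [f] forgets the middle index and [snd] the first; both keep the last, on which alone the scalars
   depend. *)
pose f (j : nat * (nat * nat)) := (j.1, j.2.2).
have pf P : U P -> W (P \o f).
  by move=> /= UP; apply: (large_sub _ UP) => i Pi; apply: large_all.
have pg P : U P -> W (P \o snd) by move=> UP; apply: (large_all U0) => i; exact: UP.
pose ci (i : nat * nat) := c i.2.
have emb := midpoint_embedding pf pg (fun _ => erefl : ci _ = ci _).
have Mm := models_uprod (U := U) (fun i => @models_scaled K (ci i)).
have Nm := models_uprod (U := W) (fun j => @models_scaled K (ci (f j))).
(* The point depends on the first index only, which the two projections read as [i] and as [j]. *)
pose x n (i : nat * nat) := if n is 0 then fib i.1.*2.+1 else fib i.1.*2.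
pose r n := cls U (S := fun i => scaled (ci i)) (x n).
have r_vertex : sat (M := uprod U _) r (cone_vertex_fm a b).
  apply/los/(large_all U0) => i; apply: (large_sub _ (U0_ge i)) => k ik.
  by apply/sat_cone_vertex; rewrite /ci ca cb; exact: fib_cone_vertex.
have [/(_ r_vertex) + _] := mc _ _ Mm Nm _ emb (cone_vertex_fm a b) r.
have -> : (fun n => midpoint W f snd (r n)) =
          fun n => cls W (S := fun j => scaled (ci (f j))) (mid f snd (x n)).
  by apply: funext => n; exact: midpoint_cls.
move/los => mid_vertex.
(* [W] quantifies [i], then [j], then [k], so each index may be taken beyond the earlier ones. *)
have lt_ijk : W (fun j => j.1 < j.2.1 <= j.2.2).
  apply: (large_all U0) => i; apply: (large_sub _ (U0_ge i.+1)) => j ij.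
  by apply: (large_sub _ (U0_ge j)) => k jk; apply/andP.
have par n := large_same_parity pf pg (x n).
have [[i [j k]]] := large_ex (iffRL (large_and W _ _) (conj mid_vertex
  (iffRL (large_and W _ _) (conj lt_ijk
  (iffRL (large_and W _ _) (conj (par 0) (par 1))))))).
case=> /sat_cone_vertex + [/andP[/= ij jk]] [par0 par1].
have ik : i <= k by lia.
rewrite /ci ca cb /mid /= => /(_ _ _ _ _ (conj (conj (fib_in_cone ik) (fib_in_cone jk)) _)).
(* Equal parities make the halves exact, so extremeness of the midpoint identifies the abscissas for
   [i] and [j], contrary to [i < j]. *)
move=> eq_mid; have /eq_mid/fib_odd_inj : fib i.*2.+1 + fib j.*2.+1 =
  (fib i.*2.+1 + fib j.*2.+1)./2 + (fib i.*2.+1 + fib j.*2.+1)./2 /\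
  fib i.*2 + fib j.*2 = (fib i.*2 + fib j.*2)./2 + (fib i.*2 + fib j.*2)./2.
  by move: par0 par1; rewrite /x /=; lia.
lia.
Qed.
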